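(* For all positive integers $k,l,q,s,t$ there are positive integers $f=f(k,l,q,s,t)$ and $g=g(q,t)$ with the following property. Let $G$ be a $t$-tidy graph containing a rigid $l$-dense $f$-banana with ends $x,z$. Then $G$ contains a clean $(x,z)$-tailed $(k,q)$-kite or an $(s,g)$-dome with root $x$.
   Context: Graphs are finite and simple; ''contains'' means as an induced subgraph. A path in $G$ is an induced subgraph that is a path. An induced minor is obtained from an induced subgraph by repeatedly contracting edges. $G$ is $t$-tidy if $G$ has no induced $K_{t+1}$ and no induced $K_{t,t}$-minor. Disjoint sets are anticomplete if no edge joins them. A $q$-banana with ends $x,y$ is a pair $(\{x,y\},\mathcal P)$ with $\mathcal P$ a set of $q$ pairwise internally disjoint $x$–$y$ paths in $G$. It is rigid if for all distinct $P_i,P_j\in\mathcal P$, $P_i\setminus\{x,y\}$ and $P_j\setminus\{x,y\}$ are not anticomplete. A $q$-theta $\Theta_{x,y}$ with ends $x,y$ is a $q$-banana whose path interiors are pairwise anticomplete. A banana $(\{x,y\},\mathcal P)$ is $l$-dense if $G[V(\mathcal P)]$ contains no $l$-theta with ends $x,y$. For distinct vertices $x,y,z$, an $(x,z)$-tailed $q$-theta is a pair $(\Theta_{x,y},P)$ where $\Theta_{x,y}$ is a $q$-theta with ends $x,y$, $P$ is a $y$–$z$ path in $G$, and $P\setminus\{y\}$ is anticomplete to $V(\Theta_{x,y})\setminus\{y\}$. An $(x,z)$-tailed $(k,q)$-kite $\mathcal K$ is a set of $k$ $(x,z)$-tailed $q$-thetas $(\Theta_{x,y_i},P_i)$, $i=1,\dots,k$,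 whose vertex sets pairwise intersect exactly in $\{x,z\}$. It is clean if for every $i$, every vertex of $V(\Theta_{x,y_i})\setminus\{x,y_i\}$ has degree two in the subgraph of $G$ induced by the union of all vertex sets of $\mathcal K$, and $\{y_1,\dots,y_k\}$ is a stable set. A subdivided star is a subdivision of $K_{1,\delta}$ with $\delta\ge 3$; its root is its unique vertex of degree $\ge3$. An $(s,d)$-dome is a pair $(S,P)$: $S$ an induced subdivided star in $G$ with leaf set $L$, $|L|=s$; $P$ a path in $G$ disjoint from $S$; $V(S)\setminus L$ anticomplete to $V(P)$; every vertex of $L$ has a neighbor in $P$; every vertex of $P$ has at most $d$ neighbors in $L$. Its root is the root of $S$.
   Formalization: The formal theorem assumes s ≥ 3 instead of s positive: a subdivided star has at least three leaves, so no (s,g)-dome exists for s = 1, 2, and the claim then fails, e.g. for theta- and triangle-free layered wheels with q = l = 3. *)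

(* Defs.v *)
From mathcomp Require Import all_boot.

Set Implicit Arguments.
Unset Strict Implicit.
Unset Printing Implicit Defensive.

(** * Finite simple graphs *)

Record sgraph := SGraph {
  vertex :> finType;
  adj : rel vertex;
  adj_sym : symmetric adj;
  adj_irrefl : irreflexive adj }.

Notation "x -- y" := (adj x y) (at level 30).

Definition iso (G H : sgraph) : Prop :=
  exists2 f : G -> H, bijective f & forall u v, f u -- f v = u -- v.

Section Constructions.
Variable G : sgraph.

Section Induced.
Variable S : {set G}.

Definition induced_rel : rel {v : G | v \in S} := fun a b => val a -- val b.

Fact induced_sym : symmetric induced_rel.
Proof. by move=> a b; rewrite /induced_rel adj_sym. Qed.

Fact induced_irrefl : irreflexive induced_rel.
Proof. by move=> a; rewrite /induced_rel adj_irrefl. Qed.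

Definition induced : sgraph := SGraph induced_sym induced_irrefl.
End Induced.

Section Contract.
Variables u v : G.

(* [v] is merged into [u]; this is the contraction of the edge [uv] when
   [u -- v]. *)
Definition contract_rel : rel {w : G | w != v} := fun a b =>
  (a != b) && [|| val a -- val b,
                  (val a == u) && v -- val b
                | (val b == u) && v -- val a].

Fact contract_sym : symmetric contract_rel.
Proof.
by move=> a b; rewrite /contract_rel eq_sym adj_sym; congr (_ && (_ || _));
  rewrite orbC.
Qed.

Fact contract_irrefl : irreflexive contract_rel.
Proof. by move=> a; rewrite /contract_rel eqxx. Qed.

Definition contract : sgraph := SGraph contract_sym contract_irrefl.

(* The edge [uv] is replaced by the path [u - None - v]. *)
Definition subdivide_rel : rel (option G) := fun a b =>
  match a, b with
  | Some a', Some b' =>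
      a' -- b' && ~~ ((a' == u) && (b' == v) || (a' == v) && (b' == u))
  | Some a', None | None, Some a' => (a' == u) || (a' == v)
  | None, None => false
  end.

Fact subdivide_sym : symmetric subdivide_rel.
Proof.
by move=> [a|] [b|] //=; rewrite adj_sym orbC [in X in _ || X]andbC
  [in X in X || _]andbC.
Qed.

Fact subdivide_irrefl : irreflexive subdivide_rel.
Proof. by move=> [a|] //=; rewrite adj_irrefl. Qed.

Definition subdivide : sgraph := SGraph subdivide_sym subdivide_irrefl.
End Contract.
End Constructions.

Fact complete_sym n : symmetric (fun i j : 'I_n => i != j).
Proof. by move=> i j; rewrite eq_sym. Qed.

Fact complete_irrefl n : irreflexive (fun i j : 'I_n => i != j).
Proof. by move=> i; rewrite eqxx. Qed.

Definition complete_graph (n : nat) : sgraph :=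
  SGraph (@complete_sym n) (@complete_irrefl n).

Definition bipartite_rel (m n : nat) : rel ('I_m + 'I_n)%type := fun a b =>
  match a, b with
  | inl _, inr _ | inr _, inl _ => true
  | _, _ => false
  end.

Fact bipartite_sym m n : symmetric (@bipartite_rel m n).
Proof. by case=> a [] b. Qed.

Fact bipartite_irrefl m n : irreflexive (@bipartite_rel m n).
Proof. by case. Qed.

Definition complete_bipartite (m n : nat) : sgraph :=
  SGraph (@bipartite_sym m n) (@bipartite_irrefl m n).

(** * Induced minors and tidy graphs *)

Definition has_induced (G H : sgraph) : Prop :=
  exists S : {set G}, iso (induced S) H.

Inductive contracts_to (G : sgraph) : sgraph -> Prop :=
| contracts_refl : contracts_to G G
| contracts_step (H : sgraph) (u v : H) :
    contracts_to G H -> u -- v -> contracts_to G (contract u v).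

Definition has_induced_minor (G H : sgraph) : Prop :=
  exists (S : {set G}) (H' : sgraph), contracts_to (induced S) H' /\ iso H' H.

Definition tidy (t : nat) (G : sgraph) : Prop :=
  ~ has_induced G (complete_graph t.+1) /\
  ~ has_induced_minor G (complete_bipartite t t).

(** * Subdivided stars *)

Inductive subdivision_of (G : sgraph) : sgraph -> Prop :=
| subdivision_refl : subdivision_of G G
| subdivision_step (H : sgraph) (u v : H) :
    subdivision_of G H -> u -- v -> subdivision_of G (subdivide u v).

Definition subdivided_star (H : sgraph) : Prop :=
  exists (delta : nat) (H' : sgraph),
    [/\ 3 <= delta, subdivision_of (complete_bipartite 1 delta) H' & iso H H'].

(** * Bananas, thetas, kites and domes

   Induced subgraphs of [G], in particular paths, are represented by their
   vertex sets. *)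

Section Configurations.
Variable G : sgraph.
Implicit Types (x y z v : G) (A B S P : {set G}) (PP : {set {set G}}).

Definition anticomplete A B : Prop :=
  [disjoint A & B] /\ {in A & B, forall a b, ~~ (a -- b)}.

(* The degree of [v] in [induced S], for [v \in S]. *)
Definition degree_in S v : nat := #|[set w in S | v -- w]|.

Definition path_between x y P : Prop :=
  exists (n : nat) (h : 'I_n.+1 -> G),
    [/\ injective h,
        forall i j, h i -- h j = (i.+1 == j :> nat) || (j.+1 == i :> nat),
        P = [set h i | i : 'I_n.+1],
        h ord0 = x
      & h ord_max = y].

Definition is_path P : Prop := exists x y, path_between x y P.

Definition interior x y P : {set G} := P :\: [set x; y].

Definition banana (q : nat) x y PP : Prop :=
  [/\ x != y,
      #|PP| = q,
      {in PP, forall P, path_between x y P}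
    & {in PP &, forall P Q,
        P != Q -> [disjoint interior x y P & interior x y Q]}].

Definition rigid x y PP : Prop :=
  {in PP &, forall P Q,
    P != Q -> ~ anticomplete (interior x y P) (interior x y Q)}.

Definition theta (q : nat) x y PP : Prop :=
  banana q x y PP /\
  {in PP &, forall P Q,
    P != Q -> anticomplete (interior x y P) (interior x y Q)}.

Definition dense (l : nat) x y PP : Prop :=
  ~ exists QQ : {set {set G}}, theta l x y QQ /\ cover QQ \subset cover PP.

(* [((y, PP), P)] stands for the pair of the banana [({x, y}, PP)] and the tail
   [P]; the vertex [x] is a parameter of the predicates below. *)
Definition tailed : finType := (G * {set {set G}} * {set G})%type.

Definition apex (T : tailed) : G := T.1.1.
Definition theta_paths (T : tailed) : {set {set G}} := T.1.2.
Definition tail (T : tailed) : {set G} := T.2.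
Definition tailed_vertices (T : tailed) : {set G} :=
  cover (theta_paths T) :|: tail T.

Definition tailed_theta (q : nat) x z (T : tailed) : Prop :=
  let y := apex T in
  [/\ [/\ x != y, y != z & x != z],
      theta q x y (theta_paths T),
      path_between y z (tail T)
    & anticomplete (tail T :\ y) (cover (theta_paths T) :\ y)].

Definition kite (k q : nat) x z (K : {set tailed}) : Prop :=
  [/\ #|K| = k,
      {in K, forall T, tailed_theta q x z T}
    & {in K &, forall T U,
        T != U -> tailed_vertices T :&: tailed_vertices U = [set x; z]}].

Definition kite_vertices (K : {set tailed}) : {set G} :=
  \bigcup_(T in K) tailed_vertices T.

Definition clean x (K : {set tailed}) : Prop :=
  {in K, forall T v,
    v \in cover (theta_paths T) :\: [set x; apex T] ->
    degree_in (kite_vertices K) v = 2} /\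
  {in K &, forall T U, ~~ (apex T -- apex U)}.

Definition star_leaves S : {set G} := [set v in S | degree_in S v == 1].

Definition star_root S x : Prop := x \in S /\ 3 <= degree_in S x.

(* As a subdivided star has at least three leaves, a dome has [3 <= s]. *)
Definition dome (s d : nat) S P : Prop :=
  let L := star_leaves S in
  [/\ subdivided_star (induced S) /\ #|L| = s,
      is_path P /\ [disjoint P & S],
      anticomplete (S :\: L) P,
      {in L, forall v, exists2 p, p \in P & v -- p}
    & {in P, forall p, #|[set v in L | p -- v]| <= d}].

End Configurations.

(* Main.v *)
Require Import Defs.
From mathcomp Require Import all_boot zify.
Set Implicit Arguments.
Unset Strict Implicit.
Unset Printing Implicit Defensive.

(** There is always a dome with [g = 1].  Let [h i j] be the first position on
  the
    [i]-th path of the banana at which a vertex with a neighbour in the interior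
    of the [j]-th path occurs.  Ramsey's theorem for triples gives many paths
    [i] and a set of targets [N] such that the initial parts of the paths [i],
    cut at their farthest first contact with a target, are pairwise
    anticomplete while each of them reaches every target.  Fix a target [N] and
    consider the first neighbour on [N] of each initial part.  If many of these
    first neighbours are distinct, order the parts along [N]; by Ramsey's
    theorem again, either the parts and the intervals of [N] between consecutive
    first neighbours contain the branch sets of a [K_{t,t}], or each part has
    neighbours only in its own interval, which is a dome.  If for every target
    most parts share their first neighbour, these shared vertices, over [t]
    targets, and [t] of the parts form a [K_{t,t}] minor. *)

(** * Ramsey theorem *)

Lemma pigeonhole (C : finType) (T : Type) (phi : T -> C) (m : nat) (s : seq T) :
  #|C| * m < size s -> exists c, m < count (fun x => phi x == c) s.
Proof.
have -> : size s = \sum_(c : C) count (fun x => phi x == c) s.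
  elim: s => [|x s IHs] /=; first by rewrite big1.
  rewrite big_split /= -IHs -add1n; congr (_ + _).
  by rewrite (bigD1 (phi x)) //= eqxx big1 // => c /negPf; rewrite eq_sym => ->.
move=> lt_s; apply/existsP; apply: contraLR lt_s => /existsPn le_m.
rewrite -leqNgt -sum_nat_const; apply: leq_sum => c _.
by rewrite leqNgt le_m.
Qed.

(** Subsequences play the part of subsets of an ordered set, so a colour may depend on the order of
    the elements. The bound is uniform in [T], hence later in the graph. *)
Definition ramsey_bound (k : nat) (C : finType) (m n : nat) : Prop :=
  forall (T : eqType) (c : seq T -> C) (s : seq T), n <= size s ->
  exists col s', [/\ subseq s' s, size s' = m &
    forall u, subseq u s' -> size u = k -> c u = col].

Lemma ramsey (k : nat) (C : finType) (m : nat) : {n | ramsey_bound k C m n}.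
Proof.
elim: k C m => [|k IHk] C m.
  exists m => T c s le_m; exists (c [::]), (take m s).
  split; [exact: take_subseq | exact: size_takel | by case].
(* Greedily, the colour of a (k+1)-subset becomes a function of its first
   element only. *)
have [n n_front] : {n | forall (T : eqType) (c : seq T -> C) (s : seq T),
    n <= size s -> exists s' (phi : T -> C),
    [/\ subseq s' s, size s' = (#|C| * m).+1 &
      forall x u, subseq (x :: u) s' -> size u = k -> c (x :: u) = phi x]}.
  elim: (#|C| * m).+1 => [|M [n IHM]].
    by exists 0 => T c s _; exists [::], (fun=> c [::]); split;
      rewrite ?sub0seq.
  (* The tail is made homogeneous for the sets starting with [x]; its length [n] is what the
     remaining greedy steps need. *)
  have [n' Hn'] := IHk C n.
  exists n'.+1 => T c [|x s] //= le_s.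
  have [col [s1 [sub1 size1 mono1]]] := Hn' T (fun u => c (x :: u)) s le_s.
  have [|s2 [phi [sub2 size2 mono2]]] := IHM T c s1; first by rewrite size1.
  exists (x :: s2), (fun y => if y == x then col else phi y).
  split=> [||y u]; first by rewrite /= eqxx (subseq_trans sub2).
    by rewrite /= size2.
  rewrite /=; case: (y =P x) => [-> sub_u|_]; last exact: mono2.
  by apply: mono1; exact: subseq_trans sub_u sub2.
exists n => T c s le_s;
  have [s1 [phi [sub1 size1 front1]]] := n_front T c s le_s.
(* More than [m] elements share a value of [phi]; on these the colour no longer depends on the first
   element. *)
have [|col lt_col] := @pigeonhole _ _ phi m s1; first by rewrite size1.
exists col, (take m [seq x <- s1 | phi x == col]).
split=> [||[|x u] // sub_u [size_u]].
- apply: (subseq_trans _ sub1); apply: (subseq_trans _ (filter_subseq _ _)).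
  exact: take_subseq.
- by rewrite size_takel // size_filter ltnW.
- have sub_f := subseq_trans sub_u (take_subseq _ _).
  have /eqP <- : phi x == col.
    by have := mem_subseq sub_f (mem_head x u); rewrite mem_filter => /andP[].
  by apply: front1 size_u; exact: subseq_trans sub_f (filter_subseq _ _).
Qed.

(** This lets Ramsey's theorem, stated for subsequences, be read at increasing positions: an
    increasing list of positions is a filtered [iota]. *)
Lemma subseq_map_nth (T : eqType) (x0 : T) (s : seq T) (ps : seq nat) :
  sorted ltn ps -> all (fun p => p < size s) ps ->
  subseq [seq nth x0 s p | p <- ps] s.
Proof.
move=> sorted_ps /allP lt_ps.
rewrite -[s in X in subseq _ X](mkseq_nth x0) /mkseq map_subseq //.
suff -> : ps = [seq p <- iota 0 (size s) | p \in ps] by exact: filter_subseq.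
apply: (irr_sorted_eq ltn_trans ltnn) => //.
  by rewrite sorted_filter ?iota_ltn_sorted //; exact: ltn_trans.
move=> p; rewrite mem_filter mem_iota add0n /=.
by case: (boolP (p \in ps)) => //= /lt_ps ->.
Qed.

(** * Spiders *)

Section Parametrisation.
Variables (T : Type) (D : T -> Prop) (R : T -> T -> bool).

(** [D] cuts out the meaningful part of a possibly infinite index type and [R] is the adjacency seen
    on indices; together they determine the graph up to isomorphism. *)
Definition parametrises (G : sgraph) (phi : T -> G) : Prop :=
  [/\ forall v, exists2 a, D a & phi a = v,
      forall a b, D a -> D b -> phi a = phi b -> a = b
    & forall a b, D a -> D b -> phi a -- phi b = R a b].

Lemma parametrises_iso (G H : sgraph) (phi : T -> G) (psi : T -> H) :
  parametrises phi -> parametrises psi -> iso G H.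
Proof.
move=> [/fin_all_exists2[g gD gK] phi_inj phi_adj].
move=> [/fin_all_exists2[h hD hK] psi_inj psi_adj].
exists (psi \o g) => [|u v] /=; last by rewrite psi_adj // -phi_adj // !gK.
exists (phi \o h) => v /=.
  by rewrite -[RHS]gK; congr phi; apply: psi_inj; rewrite ?hK.
by rewrite -[RHS]hK; congr psi; apply: phi_inj; rewrite ?gK.
Qed.
End Parametrisation.

(* [None] is the root of a spider and [Some (j, a)] the [a]-th vertex of its
   [j]-th leg, counted from 0 at the neighbour of the root; [e j] is the number
   of vertices of the [j]-th leg. *)
Definition spider_dom (s : nat) (e : 'I_s -> nat) (o : option ('I_s * nat)) :=
  if o is Some (j, a) then a < e j else true.

Definition spider_rel (s : nat) (o o' : option ('I_s * nat)) : bool :=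
  match o, o' with
  | None, Some (_, a) | Some (_, a), None => a == 0
  | Some (j, a), Some (j', b) => (j == j') && ((a.+1 == b) || (b.+1 == a))
  | None, None => false
  end.

Definition spider (s : nat) (e : 'I_s -> nat) (G : sgraph) : Prop :=
  exists phi, parametrises (spider_dom e) (@spider_rel s) (G := G) phi.

Lemma spider_star (s : nat) : spider (fun _ : 'I_s =>
  1) (complete_bipartite 1 s).
Proof.
exists (fun o => if o is Some (j, _) then inr j else inl ord0).
split.
- by move=> [i|j]; [exists None; rewrite ?(ord1 i) | exists (Some (j, 0))].
- by move=> [[j [|a]]|] [[j' [|b]]|] //= _ _ [->].
- by move=> [[j [|a]]|] [[j' [|b]]|] //=; rewrite andbF.
Qed.

(** The edge from the root to the leg [j0] is subdivided: the new vertex [None] becomes position 0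
    of that leg, whose other vertices move one step outwards. [lower] takes this shift back. *)
Lemma spider_subdivide (s : nat) (e : 'I_s -> nat) (j0 : 'I_s) (G : sgraph) :
  0 < e j0 -> spider e G ->
  exists u v : G, u -- v /\
    spider (fun j => e j + (j == j0)) (subdivide u v).
Proof.
move=> e_gt0 [phi [phi_surj phi_inj phi_adj]].
pose r := phi None; pose v0 := phi (Some (j0, 0)).
exists r, v0; split; first by rewrite phi_adj.
pose lower j a := if j == j0 then a.-1 else a.
exists (fun o => match o with
  | None => Some r
  | Some (j, a) => if (j == j0) && (a == 0) then None
                   else Some (phi (Some (j, lower j a)))
  end).
have low_dom j a : a < e j + (j == j0) -> (j == j0) && (a == 0) = false ->
    spider_dom e (Some (j, lower j a)).
  by rewrite /lower /=; case: (j =P j0) => [->|] /=; lia.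
have phiE o o' : spider_dom e o -> spider_dom e o' ->
    (phi o == phi o') = (o == o').
  move=> Do Do'; apply/eqP/eqP => [|->] //; exact: phi_inj.
split.
- move=> [v|]; last by exists (Some (j0, 0)); rewrite /= ?eqxx //; lia.
  have [[[j a]|] Da <-] := phi_surj v; last by exists None.
  exists (Some (j, a + (j == j0))); rewrite /= ?ltn_add2r //.
  rewrite /lower; case: (j =P j0) => [->|_] /=; last by rewrite addn0.
  by rewrite addn1.
- move=> [[j a]|] [[j' b]|] //= Da Db.
  + case: ifP => E1; case: ifP => E2 //.
      by case/andP: E1 E2 => /eqP-> /eqP-> /andP[/eqP-> /eqP->].
    case=> /(phi_inj _ _ (low_dom _ _ Da E1) (low_dom _ _ Db E2)) [E].
    subst j'; move: E1 E2; rewrite /lower; case: (j =P j0) => /= _ E1 E2 E.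
      by congr (Some (_, _)); lia.
    by rewrite E.
  + by case: ifP => E1 // [] /(phi_inj (Some _) None (low_dom _ _ Da E1) isT).
  + by case: ifP => E1 // [] /(phi_inj None (Some _) isT (low_dom _ _ Db E1)).
- move=> [[j a]|] [[j' b]|] //= Da Db; last by rewrite adj_irrefl.
  + case: ifP => E1; case: ifP => E2 /=.
    * by case/andP: E1 E2 => /eqP-> /eqP-> /andP[/eqP-> /eqP->]; rewrite eqxx.
    * have Db' := low_dom _ _ Db E2.
      rewrite !phiE //=; move: E1 E2 => /andP[/eqP-> /eqP->].
      by rewrite /lower (eq_sym j0) !(inj_eq Some_inj) !xpair_eqE;
        case: (j' =P j0) => //= *; lia.
    * have Da' := low_dom _ _ Da E1.
      rewrite !phiE //=; move: E2 E1 => /andP[/eqP-> /eqP->].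
      by rewrite /lower !(inj_eq Some_inj) !xpair_eqE;
        case: (j =P j0) => //= *; lia.
    * have Da' := low_dom _ _ Da E1; have Db' := low_dom _ _ Db E2.
      rewrite !phiE // phi_adj //= !andbF andbT /=.
      move: E1 E2; rewrite /lower; case: (j =P j') => [->|] //=.
      by case: (j' =P j0) => //= *; lia.
  + case: ifP => E1 /=; first by case/andP: E1 => _ /eqP->; rewrite eqxx.
    have Da' := low_dom _ _ Da E1.
    rewrite !phiE // phi_adj //= andbT /=.
    move: E1; rewrite /lower ?(inj_eq Some_inj) ?xpair_eqE;
      case: (j =P j0) => //= *; lia.
  + case: ifP => E1 /=; first by case/andP: E1 => _ /eqP->; rewrite eqxx.
    have Db' := low_dom _ _ Db E1.
    rewrite !phiE // phi_adj //= ?andbF ?orbF /=.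
    move: E1; rewrite /lower ?(inj_eq Some_inj) ?xpair_eqE;
      case: (j' =P j0) => //= *; lia.
Qed.

(** Induction on the total length of the legs: with legs of length one the spider is [K_{1,s}], and
    lengthening a leg is one subdivision at the root. *)
Lemma spider_subdivided_star (s : nat) (e : 'I_s -> nat) (G : sgraph) :
  3 <= s -> (forall j, 0 < e j) -> spider e G -> subdivided_star G.
Proof.
move=> s_ge3 e_gt0 [phi phiP].
have [H starH [psi psiP]] :
    exists2 H, subdivision_of (complete_bipartite 1 s) H & spider e H.
  have [m] := ubnP (\sum_j e j);
    elim: m e e_gt0 {G phi phiP} => // m IHm e e_gt0.
  rewrite ltnS => le_m.
  case: (boolP [forall j, e j == 1]) => [/forallP e1|/forallPn[j0 ne1]].
    exists (complete_bipartite 1 s); first exact: subdivision_refl.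
    have [psi [? ? ?]] := spider_star s; exists psi.
    have De o : spider_dom e o = spider_dom (fun _ : 'I_s => 1) o.
      by case: o => [[j a]|] //=; rewrite (eqP (e1 j)).
    split=> [v|a b|a b]; rewrite ?De; auto.
    by have [a] : exists2 a, spider_dom (fun _ : 'I_s =>
      1) a & psi a = v by []; exists a; rewrite ?De.
  pose e' j := e j - (j == j0).
  have e'_gt0 j : 0 < e' j.
    rewrite /e'; case: (j =P j0) => [->|_]; have := e_gt0 j; last lia.
    by have := e_gt0 j0; lia.
  have [|H starH spH] := IHm e' e'_gt0.
    apply: leq_trans le_m; rewrite (bigD1 j0) //= [X in _ < X](bigD1 j0) //=.
    rewrite -addSn leq_add //; first by rewrite /e' eqxx /=; have := e_gt0 j0;
      lia.
    by apply: leq_sum => j _; exact: leq_subr.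
  have [u [v [uv spH']]] := spider_subdivide (e'_gt0 j0) spH.
  exists (subdivide u v); first exact: subdivision_step.
  case: spH' => psi psiP; exists psi.
  have De o : spider_dom (fun j => e' j + (j == j0)) o = spider_dom e o.
    case: o => [[j a]|] //=; rewrite /e' subnK //.
    by case: (j =P j0) => //= ->; exact: e_gt0.
  case: psiP => p1 p2 p3; split=> [v'|a b|a b]; rewrite -?De; auto.
  by have [a Da pa] := p1 v'; exists a; rewrite -?De.
by exists s, H; split=> //; exact: parametrises_iso phiP psiP.
Qed.

Section InducedSpider.
Variables (G : sgraph) (s : nat) (e : 'I_s -> nat).
Variables (S : {set G}) (phi : option ('I_s * nat) -> G).

Definition induced_spider : Prop :=
  [/\ forall v, v \in S <-> exists2 a, spider_dom e a & phi a = v,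
      forall a b, spider_dom e a -> spider_dom e b -> phi a = phi b -> a = b
    & forall a b, spider_dom e a -> spider_dom e b ->
        phi a -- phi b = spider_rel a b].

Lemma induced_spiderP : induced_spider -> spider e (induced S).
Proof.
move=> [phiS phi_inj phi_adj].
have DS a : spider_dom e a -> phi a \in S by move=> Da; apply/phiS; exists a.
pose psi a : {v : G | v \in S} := insubd (Sub (phi None) (DS None isT)) (phi a).
have psiK a : spider_dom e a -> val (psi a) = phi a.
  by move=> Da; rewrite /psi insubdK //; have := DS a Da.
exists psi; split=> [v|a b Da Db /(congr1 val)|a b Da Db].
- have /phiS[a Da phia] := valP v.
  by exists a => //; apply: val_inj; rewrite psiK.
- by rewrite !psiK // => /phi_inj; apply.
- by rewrite /= /induced_rel !psiK // phi_adj.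
Qed.

Lemma degree_spider_root : induced_spider -> (forall j, 0 < e j) ->
  degree_in S (phi None) = s.
Proof.
move=> [phiS phi_inj phi_adj] e_gt0.
rewrite /degree_in (_ : [set w in S | _] = [set phi (Some (j, 0)) | j : 'I_s]).
  rewrite card_imset ?card_ord // => i j.
  by move=> /(phi_inj (Some (i, 0)) (Some (j, 0)) (e_gt0 i) (e_gt0 j)) [].
apply/setP=> v; rewrite inE; apply/andP/imsetP.
  move=> [/phiS[[[j a]|] Da <-]]; rewrite phi_adj //=.
  by move=> /eqP->; exists j.
move=> [j _ ->]; have Dj : spider_dom e (Some (j, 0)) := e_gt0 j.
by rewrite phi_adj //; split=> //; apply/phiS; exists (Some (j, 0)).
Qed.

Lemma star_leaves_spider : induced_spider -> (forall j, 0 < e j) -> 1 < s ->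
  star_leaves S = [set phi (Some (j, (e j).-1)) | j : 'I_s].
Proof.
move=> spS e_gt0 s_gt1; have rdeg := degree_spider_root spS e_gt0.
case: spS => [phiS phi_inj phi_adj].
have DS a : spider_dom e a -> phi a \in S by move=> Da; apply/phiS; exists a.
apply/setP=> v; rewrite inE; apply/andP/imsetP.
  move=> [/phiS[[[j a]|] /= Da <-] /eqP degv]; last first.
    by rewrite rdeg in degv; rewrite degv in s_gt1.
  exists j => //; case: (ltnP a.+1 (e j)) => [lt_a|le_a]; last first.
    by congr (phi (Some (_, _))); lia.
  (* [o] indexes the neighbour towards the root; together with the next vertex of the leg it gives
     two neighbours, so only the end of a leg can be a leaf. *)
  pose o := if a is b.+1 then Some (j, b) else None.
  have Do : spider_dom e o by rewrite /o; case: a Da {lt_a o degv} => //= a;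
    lia.
  have No : phi o != phi (Some (j, a.+1)).
    by apply/eqP=> /phi_inj => /(_ Do lt_a); rewrite /o; case: (a) => // b [];
      lia.
  suff : 1 < degree_in S (phi (Some (j, a))) by rewrite degv.
  have <- : #|[set phi o; phi (Some (j, a.+1))]| = 2 by rewrite cards2 No.
  apply/subset_leq_card/subsetP=> w; rewrite !inE => /orP[]/eqP->.
    rewrite DS //= phi_adj //= /o; case: (a) => //= b.
    by rewrite eqxx /=; lia.
  by rewrite DS //= phi_adj //= !eqxx.
move=> [j _ ->]; have lt_j : (e j).-1 < e j by have := e_gt0 j; lia.
split; first exact: DS.
pose o := if (e j).-1 is b.+1 then Some (j, b) else None.
apply/cards1P; exists (phi o); apply/setP=> w; rewrite !inE.
apply/andP/eqP => [[/phiS[c Dc <-]]|->].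
  rewrite phi_adj // => rel_c; congr phi; move: c Dc rel_c; rewrite /o.
  case Ej: (e j).-1 => [|b] [[j' c]|] //= Dc.
    by move=> /andP[/eqP E]; subst j' => Ec; exfalso; lia.
  by move=> /andP[/eqP E]; subst j' => Ec; congr (Some (_, _)); lia.
have Do : spider_dom e o by rewrite /o; case: (e j).-1 lt_j => //= b; lia.
by rewrite DS //= phi_adj //= /o; case: (e j).-1 => //= b; rewrite eqxx /=; lia.
Qed.
End InducedSpider.

(** * Induced minors *)

Definition connected_set (G : sgraph) (B : {set G}) : Prop :=
  {in B &, forall u v, connect (fun a b => [&& a \in B, b \in B & a -- b]) u v}.

Lemma connect_hom (T U : finType) (e : rel T) (e' : rel U) (f : T -> U) :
  (forall x y, e x y -> connect e' (f x) (f y)) ->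
  forall x y, connect e x y -> connect e' (f x) (f y).
Proof.
move=> ee' x _ /connectP[p e_p ->];
  elim: p x e_p => //= y p IHp x /andP[exy e_p].
exact: connect_trans (ee' _ _ exy) (IHp y e_p).
Qed.

(** The quotient map of a contraction: fibres are branch sets, and the equivalence in the last
    clause is what makes the minor induced. *)
Definition minor_map (G H : sgraph) (phi : G -> H) : Prop :=
  [/\ forall h, exists v, phi v = h,
      forall u v, phi u = phi v ->
        connect (fun a b => (phi a == phi b) && a -- b) u v
    & forall h h', h != h' ->
        h -- h' <-> exists u v, [/\ phi u = h, phi v = h' & u -- v]].

(* By contracting, one at a time, the edges inside the fibres of [phi]. *)
Lemma minor_map_contracts (G H : sgraph) (phi : G -> H) :
  minor_map phi -> exists H', contracts_to G H' /\ iso H' H.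
Proof.
suff gen m (K : sgraph) (psi : K -> H) : #|K| < m -> contracts_to G K ->
    minor_map psi -> exists H', contracts_to G H' /\ iso H' H.
  by apply: (gen #|G|.+1 G) => //; exact: contracts_refl.
elim: m K psi {phi} => // m IHm K phi; rewrite ltnS => le_m GK.
move=> [phi_surj phi_conn phi_adj].
case: (boolP (injectiveb phi)) => [/injectiveP phi_inj|].
  exists K; split=> //; exists phi.
    have [g gK] := fin_all_exists phi_surj.
    by exists g => v //; apply: phi_inj; rewrite gK.
  move=> u v; case: (u =P v) => [->|/eqP nuv]; first by rewrite !adj_irrefl.
  apply/idP/idP=> [/phi_adj|uv].
    by case=> [|u' [v' [/phi_inj-> /phi_inj->]]] //; rewrite (inj_eq phi_inj).
  by apply/phi_adj; rewrite ?(inj_eq phi_inj) //; exists u, v.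
(* A fibre with two vertices contains an edge [ua], the first one on a path between them. *)
case/injectivePn=> u [v nuv /phi_conn/connectP[[|a p] /=]].
  by move=> _ E; rewrite E eqxx in nuv.
move=> /andP[/andP[/eqP Ea ua] _] _ {v nuv p}.
have nua : u != a by apply: contraTneq ua => ->; rewrite adj_irrefl.
(* [pi] is the quotient map contracting [ua]. As [u] and [a] have the same image, [phi] factors
   through it, and the new graph has fewer vertices. *)
pose rep w := if w == a then u else w.
have repN w : rep w != a by rewrite /rep; case: ifP => // /negbT.
pose pi w : contract u a := Sub (rep w) (repN w).
have phi_pi w : phi (val (pi w)) = phi w.
  by rewrite /= /rep; case: eqP => // ->.
have piK (w : contract u a) : pi (val w) = w.
  by apply: val_inj; rewrite /= /rep (negPf (valP w)).
have pi_edge p q : p -- q -> (pi p == pi q) || pi p -- pi q.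
  move=> pq; case: eqP => //= /eqP npq; rewrite /= /contract_rel npq /= /rep.
  case: (p =P a) pq => [->|_]; case: (q =P a) => [->|_] pq;
    rewrite ?pq ?eqxx ?orbT //.
  - by rewrite adj_irrefl in pq.
  - by rewrite (adj_sym a p) pq !orbT.
have edge_pi (p q : contract u a) : p -- q ->
    exists p' q', [/\ phi p' = phi (val p), phi q' = phi (val q) & p' -- q'].
  case/andP=> _ /or3P[pq|/andP[/eqP Ep aq]|/andP[/eqP Eq ap]].
  - by exists (val p), (val q).
  - by exists a, (val q); rewrite Ep.
  - by exists (val p), a; rewrite Eq adj_sym.
apply: (IHm (contract u a) (phi \o val)).
- apply: leq_trans le_m; rewrite card_sig.
  by rewrite [X in _ < X](cardD1 a) inE add1n ltnS;
    apply/subset_leq_card/subsetP=> w; rewrite !inE andbT.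
- exact: contracts_step.
split=> [h|p q /phi_conn|h h' nh].
- by have [w <-] := phi_surj h; exists (pi w); rewrite /= -[RHS]phi_pi.
- rewrite -[X in _ -> connect _ X _]piK -[X in _ -> connect _ _ X]piK.
  move: (val p) (val q); apply: connect_hom => p' q' /andP[Epq /pi_edge].
  case/orP=> [/eqP-> //|pq]; apply: connect1.
  by rewrite pq andbT; have := phi_pi p'; have := phi_pi q';
    rewrite /= => -> ->.
- rewrite phi_adj //; split=> -[p [q [Ep Eq pq]]].
    exists (pi p), (pi q); split; rewrite -?Ep -?Eq; try exact: phi_pi.
    have := pi_edge _ _ pq; case: eqP => //= E.
    by move: nh; rewrite -Ep -Eq -phi_pi E phi_pi eqxx.
  have [p' [q' [Ep' Eq' pq']]] := edge_pi _ _ pq.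
  by exists p', q'; rewrite Ep' Eq'.
Qed.

(** On the union of the branch sets, sending each vertex to the index of its branch set is a minor
    map. *)
Lemma minor_of_branch_sets (G H : sgraph) (C : H -> {set G}) :
  (forall h, exists v, v \in C h) -> (forall h, connected_set (C h)) ->
  (forall h h', h != h' -> [disjoint C h & C h']) ->
  (forall h h', h != h' ->
     h -- h' <-> exists u v, [/\ u \in C h, v \in C h' & u -- v]) ->
  has_induced_minor G H.
Proof.
move=> C_ne C_conn C_disj C_adj.
pose S := \bigcup_h C h.
have CS h v : v \in C h -> v \in S by move=> Cv; apply/bigcupP; exists h.
have /fin_all_exists[phi phiC] (v : induced S) : exists h, val v \in C h.
  by have /bigcupP[h _] := valP v; exists h.
have phiE v h : val v \in C h -> phi v = h.
  move=> Cv; apply/eqP; apply: contraT => /C_disj/disjointFr/(_ (phiC v)).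
  by rewrite Cv.
suff : minor_map phi.
  by move=> /minor_map_contracts[H' [? ?]]; exists S, H'.
split=> [h|u v Euv|h h' nh].
- have [v Cv] := C_ne h; exists (Sub v (CS _ _ Cv)); exact: phiE.
- have Cu := phiC u; have := phiC v; rewrite -Euv => Cv.
  pose ins (w : G) : induced S := insubd u w.
  have insK w : w \in S -> val (ins w) = w by move=> Sw; rewrite /ins insubdK.
  rewrite -[u in connect _ u _](_ : ins (val u) = u);
    last exact/val_inj/insK/valP.
  rewrite -[v in connect _ _ v](_ : ins (val v) = v);
    last exact/val_inj/insK/valP.
  move: (val u) (val v) (C_conn _ _ _ Cu Cv); apply: connect_hom => a b.
  case/and3P=> Ca Cb ab; apply: connect1.
  rewrite /= /induced_rel !insK ?(CS _ _ Ca) ?(CS _ _ Cb) // ab andbT.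
  by rewrite !(phiE _ (phi u)) // insK // (CS _ _ Ca, CS _ _ Cb).
- rewrite C_adj //; split=> -[u [v [Cu Cv uv]]].
    exists (Sub u (CS _ _ Cu)), (Sub v (CS _ _ Cv)).
    by split=> //; apply: phiE.
  by exists (val u), (val v); rewrite -Cu -Cv.
Qed.

Lemma bipartite_minor (G : sgraph) (t : nat) (A B : 'I_t -> {set G}) :
  (forall i, exists v, v \in A i) -> (forall i, exists v, v \in B i) ->
  (forall i, connected_set (A i)) -> (forall i, connected_set (B i)) ->
  (forall i j, i != j -> anticomplete (A i) (A j)) ->
  (forall i j, i != j -> anticomplete (B i) (B j)) ->
  (forall i j, [disjoint A i & B j]) ->
  (forall i j, exists u v, [/\ u \in A i, v \in B j & u -- v]) ->
  has_induced_minor G (complete_bipartite t t).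
Proof.
move=> A_ne B_ne A_conn B_conn A_anti B_anti AB_disj AB_adj.
apply: (@minor_of_branch_sets _ (complete_bipartite t t)
  (fun h => match h with inl i => A i | inr j => B j end)).
- by case.
- by case.
- move=> [i|i] [j|j] // ne; last by have [] := B_anti i j ne.
    by have [] := A_anti i j ne.
  by rewrite disjoint_sym.
- move=> [i|i] [j|j] ne; split=> //=.
  + case=> u [v [Au Av uv]]; have [_ /(_ u v Au Av)] := A_anti i j ne.
    by rewrite uv.
  + by move=> _; have [u [v [Bu Av uv]]] := AB_adj j i; exists v, u;
      rewrite adj_sym.
  + case=> u [v [Au Av uv]]; have [_ /(_ u v Au Av)] := B_anti i j ne.
    by rewrite uv.
Qed.

Lemma clique_has_induced (G : sgraph) (c : seq G) :
  uniq c -> {in c &, forall u v, u != v -> u -- v} ->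
  has_induced G (complete_graph (size c)).
Proof.
move=> c_uniq c_clique; exists [set v in c].
have mem_c (i : 'I_(size c)) : tnth (in_tuple c) i \in [set v in c].
  by rewrite inE mem_tnth.
pose phi i : induced [set v in c] :=
  exist (fun v => v \in [set v in c]) (tnth (in_tuple c) i) (mem_c i).
pose psi (i : 'I_(size c)) : complete_graph (size c) := i.
suff : parametrises (fun=> True) (fun i j : 'I_(size c) => i != j) phi.
  move=> phiP; apply: (parametrises_iso (psi := psi) phiP).
  by split=> // v; exists v.
have tnth_inj : injective (tnth (in_tuple c)) by apply/tuple_uniqP.
split=> [v|i j _ _ /(congr1 val) /tnth_inj //|i j _ _].
  have /[!inE] cv := valP v.
  have /tnthP[i Ei] : val v \in in_tuple c by [].
  by exists i => //; apply: val_inj.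
rewrite /= /induced_rel /=; case: (i =P j) => [->|/eqP ne].
  by rewrite adj_irrefl.
by apply: c_clique; rewrite ?mem_tnth // (inj_eq tnth_inj).
Qed.

(** Pairs are coloured by adjacency; a homogeneous sequence of adjacent vertices would contain a
    forbidden clique. Vertices are named through [f] because legs will index them. *)
Lemma ramsey_stable (t m : nat) : {n | forall (G : sgraph) (T : eqType)
  (f : T -> G) (s : seq T),
  ~ has_induced G (complete_graph t.+1) -> uniq s -> {in s &, injective f} ->
  n <= size s -> exists s', [/\ subseq s' s, size s' = m &
    {in s' &, forall i j, ~~ (f i -- f j)}]}.
Proof.
pose M := maxn m t.+1.
have [n n_ramsey] := ramsey 2 bool M.
exists n => G T f s K_free s_uniq f_inj le_s.
pose c u := if u is [:: i; j] then f i -- f j else false.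
have [col [s' [sub size_s' mono]]] := n_ramsey T c s le_s.
have s'_uniq := subseq_uniq sub s_uniq.
have mono2 i j : i \in s' -> j \in s' -> i != j -> f i -- f j = col.
  move=> s'i s'j ne; pose p := index i s'; pose q := index j s'.
  have [lp lq] : p < size s' /\ q < size s' by rewrite !index_mem.
  have Ep : nth i s' p = i by rewrite nth_index.
  have Eq : nth i s' q = j by rewrite nth_index.
  have : p != q by apply: contra ne => /eqP Epq; rewrite -Ep -Eq Epq.
  rewrite neq_ltn => /orP[lt|lt].
    rewrite -Ep -Eq -(mono [:: nth i s' p; nth i s' q]) //.
    by apply: (@subseq_map_nth _ i s' [:: p; q]); rewrite /= ?lt ?lp ?lq.
  rewrite adj_sym -Ep -Eq -(mono [:: nth i s' q; nth i s' p]) //.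
  by apply: (@subseq_map_nth _ i s' [:: q; p]); rewrite /= ?lt ?lp ?lq.
case: col mono mono2 => _ mono2; last first.
  exists (take m s'); split.
  - exact: subseq_trans (take_subseq _ _) sub.
  - by rewrite size_takel // size_s' leq_maxl.
  - move=> i j /mem_take s'i /mem_take s'j.
    by case: (i =P j) => [->|/eqP ne]; rewrite ?adj_irrefl ?mono2.
case: K_free; pose c0 := map f (take t.+1 s').
have subs' i : i \in take t.+1 s' -> i \in s' by exact: mem_take.
have <- : size c0 = t.+1 by rewrite size_map size_takel // size_s' leq_maxr.
apply: clique_has_induced.
  rewrite map_inj_in_uniq ?take_uniq // => i j /subs' si /subs' sj.
  by apply: f_inj; exact: mem_subseq sub _ _.
move=> _ _ /mapP[i /subs' si ->] /mapP[j /subs' sj ->] ne.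
by rewrite mono2 //; apply: contra ne => /eqP->.
Qed.

(** * Legs and domes *)

(** The value is [m] if no position below [m] satisfies [p]. *)
Definition first (p : pred nat) (m : nat) : nat := find p (iota 0 m).

Lemma firstP (p : pred nat) (m a : nat) :
  a < m -> p a -> first p m <= a /\ p (first p m).
Proof.
move=> lt_a pa; have hasp : has p (iota 0 m).
  by apply/hasP; exists a => //; rewrite mem_iota.
have := nth_find 0 hasp; have := hasp; rewrite has_find size_iota => lt_f.
rewrite nth_iota // add0n; split=> //; rewrite leqNgt; apply/negP=> lt.
have := before_find 0 lt; rewrite nth_iota ?add0n ?pa //.
Qed.

Lemma first_min (p : pred nat) (m a : nat) : a < first p m -> p a = false.
Proof.
move=> lt; have := before_find 0 lt; rewrite nth_iota //.
by apply: leq_trans lt _; rewrite -[leqRHS](size_iota 0) find_size.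
Qed.

Lemma sorted_nth (T : eqType) (x0 : T) (r : rel T) (s : seq T) :
  (forall p q, p < q < size s -> r (nth x0 s p) (nth x0 s q)) -> sorted r s.
Proof.
case: s => // x s H; apply/(pathP x0) => i lt_i.
by apply: (H i i.+1); rewrite /= ltnSn.
Qed.

Definition touch (G : sgraph) (u : G) (A : {set G}) := [exists v in A, u -- v].

Lemma touchP (G : sgraph) (u : G) (A : {set G}) :
  reflect (exists2 v, v \in A & u -- v) (touch u A).
Proof. exact: exists_inP. Qed.

Section Legs.
Variables (G : sgraph) (I : finType) (x : G) (w : I -> nat -> G) (n : I -> nat).

(* [w i a] is the vertex at position [a] of the [i]-th leg.  The legs are paths
   sharing only their vertex at position 0, the root [x]; only the positions
   [a < n i] are meaningful, so that [z] is left out of the paths of a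
   banana. *)
Record legs : Prop := Legs {
  leg0 : forall i, w i 0 = x;
  leg_adj : forall i a b, a < n i -> b < n i ->
    w i a -- w i b = (a.+1 == b) || (b.+1 == a);
  leg_inj : forall i a b, a < n i -> b < n i -> w i a = w i b -> a = b;
  leg_disj : forall i j a b, i != j -> 0 < a < n i -> 0 < b < n j ->
    w i a <> w j b }.

Definition seg (i : I) (lo hi : nat) : {set G} :=
  [set v in [seq w i a | a <- iota lo (hi - lo)]].

Lemma segP i lo hi v :
  reflect (exists2 a, lo <= a < hi & v = w i a) (v \in seg i lo hi).
Proof.
rewrite inE; apply: (iffP mapP) => -[a Ha ->]; exists a => //;
  move: Ha; rewrite mem_iota; lia.
Qed.

Lemma mem_seg i lo hi a : lo <= a < hi -> w i a \in seg i lo hi.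
Proof. by move=> Ha; apply/segP; exists a. Qed.

Hypothesis Lw : legs.

Lemma leg_neq_root i a : 0 < a < n i -> w i a != x.
Proof.
move=> Ha; apply/eqP; rewrite -(leg0 Lw i) => /(leg_inj Lw); lia.
Qed.

Lemma root_leg i a : a < n i -> x -- w i a = (a == 1).
Proof. by move=> Ha; rewrite -(leg0 Lw i) (leg_adj Lw) //; lia. Qed.

Lemma seg_disjoint i j lo hi lo' hi' : i != j ->
  0 < lo -> hi <= n i -> 0 < lo' -> hi' <= n j ->
  [disjoint seg i lo hi & seg j lo' hi'].
Proof.
move=> ne ? ? ? ?; apply/pred0P => v /=; apply/negbTE/negP.
by move=> /andP[/segP[a Ha ->] /segP[b Hb]]; apply: (leg_disj Lw ne); lia.
Qed.

Lemma seg_connected i lo hi : hi <= n i -> connected_set (seg i lo hi).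
Proof.
move=> le_hi u v.
set e := fun a b : G => _; have e_sym : connect_sym e.
  by apply: sym_connect_sym => a b; rewrite /e adj_sym andbCA.
have up a k : lo <= a -> a + k < hi -> connect e (w i a) (w i (a + k)).
  elim: k => [|k IHk] le_a lt_k; first by rewrite addn0 connect0.
  apply: connect_trans (IHk le_a _) (connect1 _); first lia.
  by rewrite /e !mem_seg ?(leg_adj Lw) //; lia.
move=> /segP[a Ha ->] /segP[b Hb ->].
case: (leqP a b) => [le_ab|/ltnW le_ba]; last rewrite e_sym.
  by rewrite -(subnKC le_ab) up //; lia.
by rewrite -(subnKC le_ba) up //; lia.
Qed.

Lemma seg_path i lo hi : lo < hi <= n i -> is_path (seg i lo hi).
Proof.
move=> Hlh; exists (w i lo), (w i (lo + (hi - lo).-1)).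
exists (hi - lo).-1, (fun a => w i (lo + a)); split=> //; last by rewrite addn0.
- move=> a b E; apply/val_inj/(@addnI lo); apply: (leg_inj Lw _ _ E).
    by have := ltn_ord a; lia.
  by have := ltn_ord b; lia.
- move=> a b; have [? ?] := (ltn_ord a, ltn_ord b).
  by rewrite (leg_adj Lw); lia.
- apply/setP=> v; apply/segP/imsetP => [[a Ha ->]|[a _ ->]]; last first.
    by exists (lo + a) => //; have := ltn_ord a; lia.
  have Ha' : a - lo < (hi - lo).-1.+1 by lia.
  by exists (Ordinal Ha') => //=; congr w; lia.
Qed.

(** The root and the initial parts up to [e] form the star, and a segment of [N] is the path.
    [1 < lo] keeps the path away from the root, whose neighbour on [N] can only be at position 1;
    the last hypothesis gives the bound 1 on leaf neighbours. *)
Lemma legs_dome (s : nat) (i : 'I_s -> I) (e : 'I_s -> nat) (N : I)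
    (lo hi : nat) :
  3 <= s -> injective i -> (forall j, i j != N) ->
  (forall j, 0 < e j < n (i j)) -> 1 < lo -> lo < hi <= n N ->
  (forall j k, j != k ->
     anticomplete (seg (i j) 1 (e j).+1) (seg (i k) 1 (e k).+1)) ->
  (forall j, touch (w (i j) (e j)) (seg N lo hi)) ->
  (forall j a, 0 < a < e j -> ~~ touch (w (i j) a) (seg N lo hi)) ->
  (forall j k b, j != k -> lo <= b < hi ->
     ~~ (w (i j) (e j) -- w N b && w (i k) (e k) -- w N b)) ->
  exists S P, dome s 1 S P /\ star_root S x.
Proof.
move=> s_ge3 i_inj iN He lo_gt1 Hlh anti end_touch no_touch end_uniq.
(* Spider legs count from the neighbour of the root, hence the successor. *)
pose phi o := if o is Some (j, a) then w (i j) a.+1 else x.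
pose S := x |: \bigcup_j seg (i j) 1 (e j).+1.
pose P := seg N lo hi.
have e_gt0 j : 0 < e j by have := He j; lia.
have e_lt j : e j < n (i j) by have := He j; lia.
have phi_seg j a : a < e j -> phi (Some (j, a)) \in seg (i j) 1 (e j).+1.
  by move=> Ha; apply: mem_seg; lia.
have spS : induced_spider e S phi.
  split.
  - move=> v; rewrite !inE; split.
      case/orP=> [/eqP->|/bigcupP[j _ /segP[a Ha ->]]]; first by exists None.
      by exists (Some (j, a.-1)) => /=; rewrite ?prednK //; lia.
    case=> [[[j a]|] Da <-]; last by rewrite eqxx.
    by apply/orP; right; apply/bigcupP; exists j => //; exact: phi_seg.
  - move=> [[j a]|] [[k b]|] //= Da Db.
    + case: (j =P k) => [Ejk|/eqP ne] E.
        subst k; suff [-> //] : a.+1 = b.+1.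
        by apply: (leg_inj Lw _ _ E); have := e_lt j; lia.
      have := e_lt j; have := e_lt k => ? ?.
      have /(leg_disj Lw) : i j != i k by rewrite (inj_eq i_inj).
      by case/(_ a.+1 b.+1 _ _ E); lia.
    + by move/eqP; rewrite (negPf (leg_neq_root _)) //; have := e_lt j; lia.
    + by move/esym/eqP; rewrite (negPf (leg_neq_root _)) //; have := e_lt k;
        lia.
  - move=> [[j a]|] [[k b]|] /= Da Db; last by rewrite adj_irrefl.
    + case: (j =P k) => [Ejk|/eqP ne] /=.
        by subst k; rewrite (leg_adj Lw) //; have := e_lt j; lia.
      have [_ /(_ _ _ (phi_seg _ _ Da) (phi_seg _ _ Db))] := anti j k ne.
      exact: negbTE.
    + by rewrite adj_sym root_leg //; have := e_lt j; lia.
    + by rewrite root_leg //; have := e_lt k; lia.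
have LE : star_leaves S = [set w (i j) (e j) | j : 'I_s].
  rewrite (star_leaves_spider spS) // ?(ltnW s_ge3) //.
  by apply: eq_imset => j; rewrite /phi prednK.
have end_inj : injective (fun j => w (i j) (e j)).
  move=> j k E; apply/eqP; apply: contraT => ne.
  have /(leg_disj Lw) : i j != i k by rewrite (inj_eq i_inj).
  by case/(_ _ _ (He j) (He k) E).
have PN v : v \in P -> exists2 b, lo <= b < hi & v = w N b by move/segP.
have dPS : [disjoint P & S].
  apply/pred0P => v /=; apply/negbTE/negP => /andP[vP].
  case/setU1P=> [Ev|/bigcupP[j _ vj]].
    have [b Hb /eqP] := PN _ vP.
    by rewrite Ev eq_sym (negPf (leg_neq_root _)) //; lia.
  have := @seg_disjoint (i j) N 1 (e j).+1 lo hi (iN j) isT (e_lt j).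
  have -> : 0 < lo by lia.
  have -> : hi <= n N by lia.
  by move=> /(_ isT isT) /disjointFr/(_ vj); rewrite vP.
exists S, P; split; last first.
  by split; rewrite ?(degree_spider_root spS) // !inE eqxx.
split.
- split; first by apply: (spider_subdivided_star s_ge3 e_gt0);
    exact: induced_spiderP spS.
  by rewrite LE card_imset ?card_ord.
- by split; first exact: seg_path.
- split; first by rewrite disjoint_sym (disjointWr _ dPS) // subsetDl.
  move=> u v; rewrite LE => /setDP[uS /imsetP uL] /PN[b Hb ->].
  case/setU1P: uS => [->|/bigcupP[j _ /segP[a Ha Eu]]].
    by rewrite root_leg; lia.
  have [Ea|ne] := eqVneq a (e j); first by case: uL; exists j; rewrite // Eu Ea.
  have /no_touch : 0 < a < e j by lia.
  rewrite Eu; apply: contra => edge; apply/touchP; exists (w N b) => //.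
  exact: mem_seg.
- move=> v; rewrite LE => /imsetP[j _ ->].
  by have /touchP := end_touch j.
- move=> p /PN[b Hb ->]; rewrite leqNgt; apply/negP=> /card_gt1P[u [v [uA vA]]].
  move: uA vA; rewrite LE !inE =>
    /andP[/imsetP[j _ ->] ju] /andP[/imsetP[k _ ->] kv] ne.
  have njk : j != k by apply: contra ne => /eqP->.
  by have := end_uniq j k b njk Hb; rewrite ![_ -- w N b]adj_sym ju kv.
Qed.

End Legs.

(** * Choosing anticomplete initial parts *)

(* For [h := reach w n] below, this makes the initial parts of the legs [i] and
   [j], each cut at its first contact with the leg [k], anticomplete up to an
   edge between their ends: an edge at positions [a] and [b] satisfies
   [h i j <= a] and [h j i <= b]. *)
Definition favours (I : Type) (h : I -> I -> nat) (i j k : I) : bool :=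
  [|| h i k < h i j, h j k < h j i | (h i k <= h i j) && (h j k <= h j i)].

Lemma favoursC (I : Type) (h : I -> I -> nat) i j k :
  favours h i j k = favours h j i k.
Proof. by rewrite /favours orbCA andbC. Qed.

(** Triples are coloured by whether the first two elements favour the third and whether the last two
    favour the first. If the second bit holds, the reversed sequence works; both bits cannot fail on
    four elements, whence the 4. *)
Lemma ramsey_favours (m : nat) : {n | forall (I : eqType) (h : I -> I -> nat)
  (s : seq I), uniq s -> n <= size s ->
  exists s', [/\ uniq s', size s' = m & forall x0 p q r, p < q < r -> r < m ->
    favours h (nth x0 s' p) (nth x0 s' q) (nth x0 s' r)]}.
Proof.
have [n n_ramsey] := ramsey 3 (bool * bool)%type (maxn m 4).
exists n => I h s s_uniq le_s.
pose c u := if u is [:: i; j; k] then (favours h i j k, favours h j k i)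
            else (false, false).
have [[c1 c2] [s1 [sub size_s1 mono]]] := n_ramsey I c s le_s.
have s1_uniq := subseq_uniq sub s_uniq.
have mono3 x0 p q r : p < q < r -> r < size s1 ->
    favours h (nth x0 s1 p) (nth x0 s1 q) (nth x0 s1 r) = c1 /\
    favours h (nth x0 s1 q) (nth x0 s1 r) (nth x0 s1 p) = c2.
  move=> Hpqr lt_r; apply/pair_equal_spec.
  apply: (mono [:: nth x0 s1 p; nth x0 s1 q; nth x0 s1 r]) => //.
  by apply: (@subseq_map_nth _ x0 s1 [:: p; q; r]) => /=; lia.
have le_m : m <= size s1 by rewrite size_s1 leq_maxl.
case: c1 mono3 {mono} => mono3.
  exists (take m s1); rewrite take_uniq // size_takel //;
    split=> // x0 p q r Hp Hr.
  by rewrite !nth_take ?(proj1 (mono3 x0 p q r Hp (leq_trans Hr le_m))) //; lia.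
case: c2 mono3 => mono3.
  exists (take m (rev s1));
    rewrite take_uniq ?rev_uniq // size_takel ?size_rev //.
  split=> // x0 p q r Hp Hr; rewrite !nth_take ?nth_rev; try lia.
  rewrite favoursC; apply: (proj2 (mono3 _ _ _ _ _ _)); lia.
have : 4 <= size s1 by rewrite size_s1 leq_maxr.
(* Otherwise [h i1 i0 = h i1 i2 = h i1 i3] by the first two triples, but
   [h i1 i2 < h i1 i3] by the last one. *)
case: s1 mono3 {sub size_s1 s1_uniq le_m} =>
  [|i0 [|i1 [|i2 [|i3 s1]]]] //= mono3 _.
have := mono3 i0 0 1 2 isT isT; have := mono3 i0 0 1 3 isT isT.
have := mono3 i0 1 2 3 isT isT; rewrite /= /favours; lia.
Qed.

Section Rigid.
Variables (G : sgraph) (I : finType) (w : I -> nat -> G) (n : I -> nat).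

Definition rigid_legs : Prop := forall i j, i != j ->
  exists2 a, 0 < a < n i & touch (w i a) (seg w j 1 (n j)).

Definition hits (H : I -> nat) (i : I) (A : {set G}) : Prop :=
  exists2 a, 0 < a <= H i & touch (w i a) A.

(* [H i] is the position of the last vertex of the initial part of the leg
   [i]; the root, at position 0, is left out. *)
Record fan (H : I -> nat) (s : seq I) : Prop := Fan {
  fan_uniq : uniq s;
  fan_len : forall i, i \in s -> 0 < H i < n i;
  fan_anti : {in s &, forall i j, i != j ->
    anticomplete (seg w i 1 (H i).+1) (seg w j 1 (H j).+1)} }.

Lemma fan_subset H s s' : fan H s -> uniq s' -> {subset s' <= s} -> fan H s'.
Proof.
move=> [u l a] u' sub; split=> // [i /sub /l //|i j /sub si /sub sj].
exact: a.
Qed.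

Definition reach (i j : I) : nat :=
  first (fun a => (0 < a) && touch (w i a) (seg w j 1 (n j))) (n i).

Lemma reachP i j : rigid_legs -> i != j ->
  0 < reach i j < n i /\ touch (w i (reach i j)) (seg w j 1 (n j)).
Proof.
move=> Hr /Hr[a /andP[a_gt0 lt_a] ta].
have [|le_r /andP[-> ->]] :=
  @firstP (fun a => (0 < a) && touch (w i a) (seg w j 1 (n j))) (n i) a lt_a.
  by rewrite a_gt0.
by split=> //; exact: leq_ltn_trans le_r lt_a.
Qed.

Lemma reach_min i j a : 0 < a < n i -> touch (w i a) (seg w j 1 (n j)) ->
  reach i j <= a.
Proof. by move=> /andP[a_gt0 lt_a] ta; apply: (firstP lt_a _).1;
  rewrite a_gt0. Qed.
End Rigid.

(** The first [m0] elements are sources and the rest targets. Sources with a common farthest target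
    [N] are cut at their first contact with [N], so each part still meets every target, and
    [favours] leaves only edges between ends. *)
Lemma select_fan (t m tau : nat) : {n0 | forall (G : sgraph) (I : finType)
  (x : G) (w : I -> nat -> G) (n : I -> nat),
  ~ has_induced G (complete_graph t.+1) ->
  legs x w n -> rigid_legs w n -> n0 <= #|I| ->
  exists s T H, [/\ fan w n H s, size s = m, uniq T, size T = tau.+1 &
    {in s & T, forall i j, i != j /\ hits w H i (seg w j 1 (n j))}]}.
Proof.
have [M M_stable] := ramsey_stable t m.
have [m0 lt_m0] : {m0 | #|'I_tau.+1| * M < m0} by exists (#|'I_tau.+1| * M).+1.
have [n0 n0_fav] := ramsey_favours (m0 + tau.+1).
exists n0 => G I x w n K_free Lw rig le_I; pose h := reach w n.
have [|s1 [s1_uniq size_s1 fav]] := n0_fav I h (enum I) (enum_uniq _).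
  by rewrite -cardE.
have [x0 _] : exists x0 : I, x0 \in s1.
  case: s1 size_s1 {fav s1_uniq} => [|y s1]; last by exists y; rewrite mem_head.
  by rewrite addnS.
have [s0_uniq T_uniq disj] : [/\ uniq (take m0 s1), uniq (drop m0 s1) &
    {in take m0 s1 & drop m0 s1, forall i j, i != j}].
  move: s1_uniq; rewrite -{1}(cat_take_drop m0 s1) cat_uniq =>
    /and3P[-> /hasPn d ->].
  by split=> // i j si Tj; apply: contraTneq si => ->; exact: d.
set s0 := take m0 s1 in s0_uniq disj; set T := drop m0 s1 in T_uniq disj.
have size_s0 : size s0 = m0 by rewrite size_takel // size_s1 leq_addr.
have size_T : size T = tau.+1 by rewrite size_drop size_s1 addKn.
have {}fav i j k : i \in s0 -> j \in s0 -> i != j -> k \in T -> favours h i j k.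
  have fav_lt p q : p < q < m0 -> k \in T ->
    favours h (nth x0 s0 p) (nth x0 s0 q) k.
    move=> Hpq kT; rewrite -(nth_index x0 kT) /T nth_drop !nth_take; try lia.
    have := kT; rewrite -index_mem size_T => lt_k.
    by apply: fav; [lia|rewrite ltn_add2l].
  move=> si sj ne kT; rewrite -(nth_index x0 si) -(nth_index x0 sj).
  move: (si) (sj); rewrite -!index_mem size_s0 => li lj.
  have : index i s0 != index j s0.
    by apply: contra ne => /eqP E; rewrite -(nth_index x0 si) E nth_index.
  rewrite neq_ltn => /orP[lt|lt]; last rewrite favoursC; by apply: fav_lt;
    rewrite ?lt.
pose tgt (k : 'I_tau.+1) := nth x0 T k.
have tgtT k : tgt k \in T by rewrite mem_nth // size_T.
pose far i := [arg max_(k > ord0) h i (tgt k)].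
have farP i k : h i (tgt k) <= h i (tgt (far i)).
  by rewrite /far; case: arg_maxnP => // k' _; apply.
have [|k lt_k] := @pigeonhole _ _ far M s0; first by rewrite size_s0.
pose s' := [seq i <- s0 | far i == k]; pose N := tgt k.
have s'_uniq : uniq s' by rewrite filter_uniq.
have s's0 i : i \in s' -> i \in s0 by rewrite mem_filter => /andP[].
have hN i : i \in s' ->
  0 < h i N < n i /\ touch (w i (h i N)) (seg w N 1 (n N)).
  by move=> /s's0 si; apply: (reachP rig); exact: disj si (tgtT k).
(* Edges between the ends of the parts are removed by passing to a stable set of ends. *)
have [||s [sub size_s stab]] :=
  M_stable G I (fun i => w i (h i N)) s' K_free s'_uniq.
- move=> i j s'i s'j E; apply/eqP; apply: contraT => /(leg_disj Lw).
  by case/(_ _ _ (hN i s'i).1 (hN j s'j).1 E).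
- by rewrite size_filter ltnW.
have ss' := mem_subseq sub.
exists s, T, (fun i => h i N); split=> // [|i j si Tj]; last first.
  have nij : i != j by apply: disj Tj; apply/s's0/ss'.
  split=> //; have [/andP[gt0 _] tch] := reachP rig nij.
  exists (h i j); rewrite // gt0 /=.
  have := ss' i si; rewrite mem_filter => /andP[/eqP far_i _].
  have lt_j : index j T < tau.+1 by rewrite -size_T index_mem.
  have -> : j = tgt (Ordinal lt_j) by rewrite /tgt /= nth_index.
  by rewrite /N -far_i farP.
split=> [|i /ss' /hN[] //|i j si sj nij]; first exact: subseq_uniq sub s'_uniq.
have [[Hi _] [Hj _]] := (hN i (ss' i si), hN j (ss' j sj)).
split; first by apply: (seg_disjoint Lw nij); lia.
move=> _ _ /segP[a Ha ->] /segP[b Hb ->]; apply/negP=> ab.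
(* An edge between two parts is a contact of each leg with the other, so it comes no earlier than
   the first contact. *)
have le_a : h i j <= a.
  apply: reach_min; first lia.
  by apply/touchP; exists (w j b) => //; apply: mem_seg; lia.
have le_b : h j i <= b.
  apply: reach_min; first lia.
  by apply/touchP; exists (w i a); [apply: mem_seg; lia | rewrite adj_sym].
have := fav i j N (s's0 _ (ss' _ si)) (s's0 _ (ss' _ sj)) nij (tgtT k).
(* The strict alternatives would put the edge beyond a cut; the third forces it to join the two
   ends. *)
rewrite /favours => /or3P[||Hle]; try lia.
have [Ea Eb] : a = h i N /\ b = h j N by lia.
by have := stab i j si sj; rewrite -Ea -Eb ab.
Qed.

(** * Contacts with a target *)

Section Contact.
Variables (G : sgraph) (I : finType) (w : I -> nat -> G) (n : I -> nat).
Variables (H : I -> nat) (N : I).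

(** Positions run along the target [N] here, whereas [reach] measures along the leg [i]. *)
Definition contact (i : I) : nat :=
  first (fun b => (0 < b) && touch (w N b) (seg w i 1 (H i).+1)) (n N).

Lemma contactP i : hits w H i (seg w N 1 (n N)) ->
  0 < contact i < n N /\ touch (w N (contact i)) (seg w i 1 (H i).+1).
Proof.
case=> a Ha /touchP[_ /segP[b Hb ->] ab].
have [||le_c /andP[-> ->]] := @firstP (fun b => (0 < b) &&
  touch (w N b) (seg w i 1 (H i).+1)) (n N) b; first by case/andP: Hb.
  case/andP: Hb => -> _; apply/touchP; exists (w i a); last by rewrite adj_sym.
  exact: mem_seg.
by split=> //; apply: leq_ltn_trans le_c _; case/andP: Hb.
Qed.

Lemma contact_min i a b : 0 < a <= H i -> 0 < b < n N -> w i a -- w N b ->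
  contact i <= b.
Proof.
move=> Ha /andP[b_gt0 lt_b] ab; apply: (firstP lt_b _).1; rewrite b_gt0.
by apply/touchP; exists (w i a); [exact: mem_seg | rewrite adj_sym].
Qed.
End Contact.

Lemma sorted_nth_lt (I : eqType) (f : I -> nat) (s : seq I) x0 p q :
  sorted (relpre f ltn) s -> p < q < size s -> f (nth x0 s p) < f (nth x0 s q).
Proof.
move=> srt /andP[lt_pq lt_q].
have tr : transitive (relpre f ltn) by move=> ? ? ?; exact: ltn_trans.
have := sorted_ltn_nth tr x0 srt p q; apply=> //; exact: ltn_trans lt_pq lt_q.
Qed.

(** A triple is coloured by whether its first part has a neighbour on [N] between the contacts of
    the other two. One colour yields a [K_{t,t}] minor, the other a dome. *)
Lemma fan_increasing (s t : nat) : {K | forall (G : sgraph) (I : finType)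
  (x : G) (w : I -> nat -> G) (n : I -> nat) (H : I ->
    nat) (N : I) (s1 : seq I),
  3 <= s -> ~ has_induced_minor G (complete_bipartite t t) ->
  legs x w n -> fan w n H s1 -> N \notin s1 ->
  {in s1, forall i, hits w H i (seg w N 1 (n N))} ->
  sorted (relpre (contact w n H N) ltn) s1 -> K <= size s1 ->
  exists S P, dome s 1 S P /\ star_root S x}.
Proof.
(* The minor takes [t] parts and the ends of [t] intervals; the dome takes [s] parts and one further
   part on each side. *)
have [K K_ramsey] := ramsey 3 bool (3 * t + s.+2).
exists K => G I x w n H N s1 s_ge3 no_minor Lw fan1 Ns1 hit1 srt1 le_K.
pose l := contact w n H N; pose Q i := seg w i 1 (H i).+1.
pose c u := if u is [:: i; j; k]
  then [exists v in Q i, touch v (seg w N (l j) (l k))] else false.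
have [col [s2 [sub size_s2 mono]]] := K_ramsey I c s1 le_K.
have ss := mem_subseq sub.
have fan2 := fan_subset fan1 (subseq_uniq sub (fan_uniq fan1)) ss.
have srt2 : sorted (relpre l ltn) s2.
  by apply: subseq_sorted sub srt1 => ? ? ?; exact: ltn_trans.
have [x0 _] : exists x0 : I, x0 \in s2.
  by case: (s2) size_s2 => [/=|y s3 _]; [lia | exists y; rewrite mem_head].
pose a p := nth x0 s2 p.
have s2a p : p < size s2 -> a p \in s2 by move=> lt_p; exact: mem_nth.
have a_inj p q : p < size s2 -> q < size s2 -> p != q -> a p != a q.
  by move=> lp lq; rewrite nth_uniq ?(fan_uniq fan2).
have incr p q : p < q < size s2 -> l (a p) < l (a q).
  exact: sorted_nth_lt.
have aN p : p < size s2 -> a p != N.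
  by move=> /s2a/ss; apply: contraTneq => ->.
have hit p : p < size s2 ->
  0 < l (a p) < n N /\ touch (w N (l (a p))) (Q (a p)).
  by move=> /s2a/ss/hit1/contactP.
have len p : p < size s2 -> 0 < H (a p) < n (a p).
  by move=> /s2a/(fan_len fan2).
have {}mono p q r : p < q < r -> r < size s2 ->
    [exists v in Q (a p), touch v (seg w N (l (a q)) (l (a r)))] = col.
  move=> Hpqr lt_r; apply: (mono [:: a p; a q; a r]) => //.
  have [lt_p lt_q] : p < size s2 /\ q < size s2 by lia.
  apply: (@subseq_map_nth _ x0 s2 [:: p; q; r]) => /=; first by lia.
  by apply/and4P.
case: col mono => mono.
  case: no_minor; pose A (k : 'I_t) := Q (a k).
  (* Taking every other interval leaves a gap that makes the branch sets anticomplete. The offset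
     [t] puts every interval after the parts in [A], as the colour requires. *)
  pose B (k : 'I_t) := seg w N (l (a (t + 2 * k))) (l (a (t + 2 * k).+1)).
  have lt_B (k : 'I_t) : (t + 2 * k).+1 < size s2.
    by rewrite size_s2; have := ltn_ord k; lia.
  have lt_A (k : 'I_t) : k < size s2 by have := lt_B k; have := ltn_ord k; lia.
  have leB (k : 'I_t) : 0 < l (a (t + 2 * k)) /\ l (a (t + 2 * k).+1) <= n N.
    by have := hit _ (lt_B k); have := hit _ (ltnW (lt_B k)); lia.
  have antiB (j k : 'I_t) : j < k -> anticomplete (B j) (B k).
    move=> lt_jk.
    have lt_l : l (a (t + 2 * j).+1) < l (a (t + 2 * k)).
      by apply: incr; have := lt_B k; lia.
    have [[? ?] [? ?]] := (leB j, leB k); split.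
      apply/pred0P => v /=;
        apply/negbTE/negP => /andP[/segP[b Hb ->] /segP[b' Hb']].
      move=> E; suff : b = b' by lia.
      by apply: (leg_inj Lw _ _ E); lia.
    move=> _ _ /segP[b Hb ->] /segP[b' Hb' ->].
    by rewrite (leg_adj Lw); lia.
  have anticompleteC (C D : {set G}) : anticomplete C D -> anticomplete D C.
    move=> [d e]; split=> [|u v Du Cv]; first by rewrite disjoint_sym.
    by rewrite adj_sym e.
  apply: (bipartite_minor (A := A) (B := B)).
  - move=> k; exists (w (a k) 1); apply: mem_seg.
    by have := len k (lt_A k); lia.
  - move=> k; exists (w N (l (a (t + 2 * k)))); apply: mem_seg.
    by rewrite leqnn incr // ltnSn lt_B.
  - by move=> k; apply: (seg_connected Lw); have := len k (lt_A k); lia.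
  - by move=> k; apply: (seg_connected Lw); have := leB k; lia.
  - move=> j k ne; apply: (fan_anti fan2); try exact: s2a.
    by apply: a_inj.
  - move=> j k; rewrite neq_ltn => /orP[/antiB //|/antiB/anticompleteC //].
  - move=> j k; apply: (seg_disjoint Lw); have := leB k; have := len j (lt_A j);
      try lia.
    by move=> *; exact: aN.
  - move=> j k; have := mono j (t + 2 * k) (t + 2 * k).+1.
    have -> : j < t + 2 * k < (t + 2 * k).+1 by have := ltn_ord j; lia.
    move=> /(_ isT (lt_B k)) /exists_inP[u Qu /touchP[v Bv uv]].
    by exists u, v.
have lt_s p : p <= s.+1 -> p < size s2 by rewrite size_s2; lia.
(* Element 0 ensures [1 < lo], element [s.+1] supplies [hi], and the [s] parts between them carry
   the leaves. *)
pose lo := l (a 1); pose hi := l (a s.+1); pose P := seg w N lo hi.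
pose i (j : 'I_s) := a j.+1.
have lt_i (j : 'I_s) : j.+1 < size s2 by apply: lt_s; have := ltn_ord j; lia.
(* Each leg is cut again, at its first contact with [P]; this comes no later than [H (i j)] because
   position [l (i j)] lies on [P]. *)
pose e j := first (fun b => (0 < b) && touch (w (i j) b) P) (n (i j)).
have lo_gt1 : 1 < lo.
  have : l (a 0) < l (a 1) by apply: incr; rewrite lt_s.
  by have := hit 0 (lt_s 0 isT); lia.
have hi_lt : hi < n N by have := hit s.+1 (lt_s _ (leqnn _)); rewrite -/hi; lia.
have lo_l (j : 'I_s) : lo <= l (i j).
  case: (posnP j) => [j0|j_gt0]; first by rewrite /i j0.
  by apply/ltnW/incr; rewrite lt_i; lia.
have l_hi (j : 'I_s) : l (i j) < hi.
  by apply: incr; rewrite lt_s // andbT; have := ltn_ord j; lia.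
have len_i j : 0 < H (i j) < n (i j) := len _ (lt_i j).
have hit_i j : touch (w N (l (i j))) (Q (i j)) := (hit _ (lt_i j)).2.
have eP j : [/\ 0 < e j, e j <= H (i j) & touch (w (i j) (e j)) P].
  have /touchP[_ /segP[b Hb ->] Nb] := hit_i j; have := len_i j => Hlen.
  have [||le_e /andP[-> ->]] := @firstP (fun b => (0 < b) &&
    touch (w (i j) b) P) (n (i j)) b; first lia.
    apply/andP; split; first by lia.
    apply/touchP; exists (w N (l (i j))); last by rewrite adj_sym.
    by apply: mem_seg; rewrite lo_l l_hi.
  by split=> //; apply: leq_trans le_e _; lia.
have e_lt j : 0 < e j < n (i j).
  by have [? ? _] := eP j; have := len_i j; lia.
have seg_e j : {subset seg w (i j) 1 (e j).+1 <= Q (i j)}.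
  move=> _ /segP[b Hb ->]; apply: mem_seg.
  by have [_ ? _] := eP j; lia.
have end_uniq (j k : 'I_s) b : j < k -> lo <= b < hi ->
    w (i j) (e j) -- w N b -> w (i k) (e k) -- w N b -> False.
  move=> lt_jk Hb jb kb.
  (* A common neighbour lies beyond the first contact of the later part, where the colour forbids
     neighbours of the earlier part. *)
  have le_b : l (i k) <= b.
    apply: contact_min kb; last lia.
    by have [-> ->] := eP k.
  have := mono j.+1 k.+1 s.+1; rewrite lt_s // !ltnS lt_jk ltn_ord.
  move=> /(_ isT isT) /negbT/exists_inP; apply.
  exists (w (i j) (e j)); first by apply: mem_seg; case: (eP j);
    rewrite ltnS => -> ->.
  by apply/touchP; exists (w N b) => //; apply: mem_seg; rewrite -/(i k) le_b;
    case/andP: Hb.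
apply: (legs_dome Lw (i := i) (e := e) (N := N) (lo := lo) (hi := hi)) => //.
- move=> j k E; apply/val_inj/eqP; apply: contraT => ne.
  have := a_inj j.+1 k.+1 (lt_i j) (lt_i k); rewrite eqSS ne => /(_ isT).
  by rewrite -/(i j) -/(i k) E eqxx.
- by move=> j; exact: aN.
- by have := lo_l (Ordinal s_ge3); have := l_hi (Ordinal s_ge3); lia.
- move=> j k ne; have [|d anti] :=
    fan_anti fan2 (s2a _ (lt_i j)) (s2a _ (lt_i k)).
    by apply: a_inj; rewrite ?eqSS.
  split; last by move=> u v /seg_e Qu /seg_e; exact: anti.
  apply: disjointWl (disjointWr _ d); apply/subsetP; exact: seg_e.
- by move=> j; have [] := eP j.
- move=> j b /andP[b_gt0 /first_min]; rewrite b_gt0 /= => -> //.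
- move=> j k b; rewrite neq_ltn => ne Hb; apply/negP => /andP[jb kb].
  by case/orP: ne => [lt|lt]; apply: end_uniq lt Hb _ _.
Qed.

(** Pairs are coloured by the order of their contacts. Increasing contacts give a dome, decreasing
    ones do so after reversal, and otherwise all contacts coincide at [p]. *)
Lemma fan_target (m s t : nat) : {M | forall (G : sgraph) (I : finType)
  (x : G) (w : I -> nat -> G) (n : I -> nat) (H : I ->
    nat) (N : I) (s0 : seq I),
  3 <= s -> ~ has_induced_minor G (complete_bipartite t t) ->
  legs x w n -> fan w n H s0 -> N \notin s0 ->
  {in s0, forall i, hits w H i (seg w N 1 (n N))} -> M <= size s0 ->
  (exists S P, dome s 1 S P /\ star_root S x) \/
  exists s1 p, [/\ fan w n H s1, {subset s1 <= s0}, size s1 = m, 0 < p < n N &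
    {in s1, forall i, touch (w N p) (seg w i 1 (H i).+1)}]}.
Proof.
have [K K_dome] := fan_increasing s t.
(* The successor makes the homogeneous sequence nonempty, so that [x0] exists. *)
have [M M_ramsey] := ramsey 2 (bool * bool)%type (maxn m K).+1.
exists M => G I x w n H N s0 s_ge3 no_minor Lw fan0 Ns0 hit0 le_M.
pose l := contact w n H N.
pose c u := if u is [:: i; j] then (l i < l j, l j < l i) else (false, false).
have [[c1 c2] [s1 [sub size_s1 mono]]] := M_ramsey I c s0 le_M.
have ss := mem_subseq sub.
have s1_uniq := subseq_uniq sub (fan_uniq fan0).
have fan1 := fan_subset fan0 s1_uniq ss.
have [x0 s1x0] : exists x0 : I, x0 \in s1.
  by case: (s1) size_s1 => [|y s2 _] //; exists y; rewrite mem_head.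
have {}mono p q : p < q -> q < size s1 ->
    l (nth x0 s1 p) < l (nth x0 s1 q) = c1 /\
    l (nth x0 s1 q) < l (nth x0 s1 p) = c2.
  move=> lt_pq lt_q; have lt_p := ltn_trans lt_pq lt_q.
  apply/pair_equal_spec; apply: (mono [:: nth x0 s1 p; nth x0 s1 q]) => //.
  apply: (@subseq_map_nth _ x0 s1 [:: p; q]); first by rewrite /= lt_pq.
  by apply/and3P.
have K_s1 : K <= size s1 by rewrite size_s1 leqW ?leq_maxr.
case: c1 mono => mono.
  left; apply: (K_dome G I x w n H N s1) => //.
  - by apply: contra Ns0; exact: ss.
  - by move=> i /ss /hit0.
  - apply: (@sorted_nth _ x0) => p q /andP[lt_pq lt_q].
    by rewrite /= (mono p q lt_pq lt_q).1.
case: c2 mono => mono.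
  left; apply: (K_dome G I x w n H N (rev s1)); rewrite ?mem_rev ?size_rev //.
  - by apply: (fan_subset fan1); rewrite ?rev_uniq // => i; rewrite mem_rev.
  - by apply: contra Ns0; exact: ss.
  - by move=> i; rewrite mem_rev => /ss /hit0.
  - apply: (@sorted_nth _ x0) => p q; rewrite size_rev => /andP[lt_pq lt_q].
    have lt_p := ltn_trans lt_pq lt_q.
    by rewrite /= !nth_rev // (mono (size s1 - q.+1) (size s1 - p.+1) _ _).2
      //; lia.
have l_const i : i \in s1 -> l i = l x0.
  move=> si; rewrite -(nth_index x0 si) -[in RHS](nth_index x0 s1x0).
  have lt_i : index i s1 < size s1 by rewrite index_mem.
  have lt_0 : index x0 s1 < size s1 by rewrite index_mem.
  case: (ltngtP (index i s1) (index x0 s1)) => [lt|lt|-> //].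
    have [/negbT + /negbT] := mono _ _ lt lt_0; rewrite -!leqNgt => le1 le2.
    by apply/eqP; rewrite eqn_leq le1 le2.
  have [/negbT + /negbT] := mono _ _ lt lt_i; rewrite -!leqNgt => le1 le2.
  by apply/eqP; rewrite eqn_leq le1 le2.
right; exists (take m s1), (l x0);
  have sub_take i : i \in take m s1 -> i \in s1.
  exact: mem_take.
have [l_bd _] := contactP (hit0 _ (ss _ s1x0)).
split=> [|i /sub_take /ss //|||i /sub_take si] //.
- exact: fan_subset fan1 (take_uniq _ s1_uniq) sub_take.
- by rewrite size_takel // size_s1 leqW ?leq_maxl.
- by rewrite -(l_const i si); have [] := contactP (hit0 _ (ss _ si)).
Qed.

(** Targets are treated one at a time on shrinking fans; what holds at an earlier target concerns
    each part separately and so survives. *)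
Lemma fan_targets (tau m s t : nat) : {M | forall (G : sgraph) (I : finType)
  (x : G) (w : I -> nat -> G) (n : I -> nat) (H : I -> nat) (T s0 : seq I),
  3 <= s -> ~ has_induced_minor G (complete_bipartite t t) ->
  legs x w n -> fan w n H s0 -> size T = tau ->
  {in s0 & T, forall i j, i != j /\ hits w H i (seg w j 1 (n j))} ->
  M <= size s0 ->
  (exists S P, dome s 1 S P /\ star_root S x) \/
  exists s1 p, [/\ fan w n H s1, {subset s1 <= s0}, size s1 = m &
    {in T, forall j, 0 < p j < n j /\
       {in s1, forall i, touch (w j (p j)) (seg w i 1 (H i).+1)}}]}.
Proof.
elim: tau => [|tau [M IH]].
  exists m => G I x w n H T s0 _ _ _ fan0 /size0nil-> _ le_m; right.
  have sub i : i \in take m s0 -> i \in s0 by exact: mem_take.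
  exists (take m s0), (fun=> 0); split=> //; last by rewrite size_takel.
  by apply: (fan_subset fan0 _ sub); rewrite take_uniq // (fan_uniq fan0).
(* The first target must leave [M] parts for the others. *)
have [M' M'_target] := fan_target M s t.
exists M' => G I x w n H [|N T] s0 // s_ge3 no_minor Lw fan0 [size_T] hit0
  le_M'.
have hitN i : i \in s0 -> i != N /\ hits w H i (seg w N 1 (n N)).
  by move=> si; apply: hit0; rewrite ?mem_head.
have Ns0 : N \notin s0 by apply/negP => /hitN[/eqP].
have [|[s1 [p0 [fan1 ss1 size_s1 p0_bd touch1]]]] := M'_target G I x w n H N s0
  s_ge3 no_minor Lw fan0 Ns0 (fun i si => (hitN i si).2) le_M'; first by left.
have [|||[s2 [p [fan2 ss2 size_s2 Hp]]]] :=
  IH G I x w n H T s1 s_ge3 no_minor Lw fan1 size_T.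
- by move=> i j /ss1 si Tj; apply: hit0; rewrite // inE Tj orbT.
- by rewrite size_s1.
- by left.
right; exists s2, (fun j => if j == N then p0 else p j).
split=> [//|i /ss2/ss1 //|//|j]; rewrite inE.
by case: eqP => [-> _|_ /= /Hp //]; split=> // i /ss2/touch1.
Qed.

(** Without a dome, every target has a vertex touched by all remaining parts; [t] pairwise
    nonadjacent such vertices and [t] parts are the branch sets of a [K_{t,t}]. *)
Lemma rigid_legs_dome (s t : nat) : {M | forall (G : sgraph) (I : finType)
  (x : G) (w : I -> nat -> G) (n : I -> nat),
  3 <= s -> tidy t G -> legs x w n -> rigid_legs w n -> M <= #|I| ->
  exists S P, dome s 1 S P /\ star_root S x}.
Proof.
(* Bounds are chosen backwards: [tau] targets suffice for [t] nonadjacent shared vertices, [m] parts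
   leave [t] after all targets, and [M] legs provide the fan. *)
have [tau tau_stable] := ramsey_stable t t.
have [m m_targets] := fan_targets tau.+1 t s t.
have [M M_fan] := select_fan t m tau.
exists M => G I x w n s_ge3 [K_free no_minor] Lw rig le_M.
have [s0 [T [H [fan0 size_s0 T_uniq size_T hit0]]]] :=
  M_fan G I x w n K_free Lw rig le_M.
have [|//|[s1 [p [fan1 ss1 size_s1 Hp]]]] :=
  m_targets G I x w n H T s0 s_ge3 no_minor Lw fan0 size_T hit0.
  by rewrite size_s0.
have [||T1 [sub size_T1 stab]] :=
  tau_stable G I (fun j => w j (p j)) T K_free T_uniq.
- move=> i j Ti Tj E; apply/eqP; apply: contraT => /(leg_disj Lw).
  by case/(_ _ _ (Hp i Ti).1 (Hp j Tj).1 E).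
- by rewrite size_T.
have [T1_uniq sT] := (subseq_uniq sub T_uniq, mem_subseq sub).
case: no_minor.
have enumerate (u : seq I) : uniq u -> size u = t ->
    exists e : 'I_t -> I, injective e /\ forall k, e k \in u.
  move=> u_uniq size_u; exists (tnth (tcast size_u (in_tuple u))).
  split=> [|k]; last by rewrite -[X in _ \in X](val_tcast size_u (in_tuple u))
    mem_tnth.
  by apply/tuple_uniqP; rewrite val_tcast.
have [a [a_inj s1a]] := enumerate s1 (fan_uniq fan1) size_s1.
have [b [b_inj T1b]] := enumerate T1 T1_uniq size_T1.
pose y j := w j (p j).
have Hb k : 0 < p (b k) < n (b k) /\
    {in s1, forall i, touch (y (b k)) (seg w i 1 (H i).+1)} :=
      Hp _ (sT _ (T1b k)).
have Ha k : 0 < H (a k) < n (a k) := fan_len fan1 (s1a k).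
apply: (bipartite_minor (A := fun k => seg w (a k) 1 (H (a k)).+1)
  (B := fun k => seg w (b k) (p (b k)) (p (b k)).+1)).
- by move=> k; exists (w (a k) 1); apply: mem_seg; have := Ha k; lia.
- by move=> k; exists (y (b k)); apply: mem_seg; rewrite leqnn ltnSn.
- by move=> k; apply: (seg_connected Lw); have := Ha k; lia.
- by move=> k; apply: (seg_connected Lw); have := (Hb k).1; lia.
- by move=> j k ne; apply: (fan_anti fan1); rewrite ?s1a ?(inj_eq a_inj).
- move=> j k ne; have := (Hb j).1; have := (Hb k).1; split.
    by apply: (seg_disjoint Lw); rewrite ?(inj_eq b_inj) //; lia.
  move=> _ _ /segP[c Hc ->] /segP[d Hd ->].
  have -> : c = p (b j) by lia.
  have -> : d = p (b k) by lia.
  exact: stab.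
- move=> j k; have := Ha j; have := (Hb k).1; move=> ? ?.
  by apply: (seg_disjoint Lw);
    rewrite ?(hit0 _ _ (ss1 _ (s1a j)) (sT _ (T1b k))).1 //; lia.
- move=> j k; have /touchP[v Av yv] := (Hb k).2 _ (s1a j).
  exists v, (y (b k)); rewrite adj_sym; split=> //.
  by apply: mem_seg; rewrite leqnn ltnSn.
Qed.

(** * Rigid bananas as legs *)

Theorem theorem6p2 :
  exists (f : nat -> nat -> nat -> nat -> nat -> nat) (g : nat -> nat -> nat),
  forall k l q s t : nat,
    0 < k -> 0 < l -> 0 < q -> 3 <= s -> 0 < t ->
    [/\ 0 < f k l q s t, 0 < g q t &
      forall (G : sgraph) (x z : G) (PP : {set {set G}}),
        tidy t G ->
        banana (f k l q s t) x z PP -> rigid x z PP -> dense l x z PP ->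
        (exists K : {set tailed G}, kite k q x z K /\ clean x K) \/
        (exists S P : {set G}, dome s (g q t) S P /\ star_root S x)].
Proof.
(* The successor makes [f] positive; [g] is 1 because [rigid_legs_dome] yields domes with at most
   one leaf neighbour per path vertex. *)
exists (fun k l q s t => (sval (rigid_legs_dome s t)).+1), (fun _ _ => 1).
move=> k l q s t _ _ _ s_ge3 _; case: (rigid_legs_dome s t) => M M_dome /=.
split=> // G x z PP tidyG [xz size_PP paths disj] rig _; right.
have idx (i : 'I_#|PP|) : enum_val i \in PP := enum_valP i.
(* Each path is indexed by natural numbers, from [x] at position 0 to [z] at position [u.1]. *)
have /fin_all_exists[u uP] (i : 'I_#|PP|) : exists u : nat * (nat -> G),
    [/\ u.2 0 = x, u.2 u.1 = z,
      forall a b, a <= u.1 -> b <= u.1 -> u.2 a = u.2 b -> a = b,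
      forall a b, a <= u.1 -> b <= u.1 ->
        u.2 a -- u.2 b = (a.+1 == b) || (b.+1 == a)
    & forall v, v \in enum_val i <-> exists2 a, a <= u.1 & v = u.2 a].
  have [n [h [h_inj h_adj -> hx hz]]] := paths _ (idx i).
  exists (n, fun a => h (inord a)); split=> /=.
  - by rewrite -hx; congr h; apply: val_inj; rewrite /= inordK.
  - by rewrite -hz; congr h; apply: val_inj; rewrite /= inordK.
  - by move=> a b ? ? /h_inj /(congr1 val); rewrite /= !inordK.
  - by move=> a b ? ?; rewrite h_adj !inordK.
  - move=> v; split=> [/imsetP[a _ ->]|[a ? ->]].
      by exists a; rewrite ?inord_val // -ltnS.
    by apply/imsetP; exists (inord a).
(* Position [n i] is [z], so the bound [a < n i] in [legs] leaves [z] out. *)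
pose n i := (u i).1; pose w i := (u i).2.
have intP i v : v \in interior x z (enum_val i) <-> exists2 a, 0 < a < n i &
  v = w i a.
  have [u0 uz u_inj _ uS] := uP i.
  rewrite !inE negb_or; split=> [/andP[/andP[vx vz] /uS[a le_a Ev]]|[a Ha Ev]].
    exists a => //; rewrite lt0n ltn_neqAle le_a andbT.
    apply/andP; split; first by apply: contra vx => /eqP a0; rewrite Ev a0 u0.
    by apply: contra vz => /eqP a0; rewrite Ev a0 uz.
  have le_a : a <= n i by lia.
  have -> : v \in enum_val i by apply/uS; exists a.
  rewrite andbT -uz -{1}u0 Ev; apply/andP; split.
    by apply/eqP => /(u_inj _ _ le_a (leq0n _)); lia.
  by apply/eqP => /(u_inj _ _ le_a (leqnn _)); rewrite /n in Ha; lia.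
have int_disj (i j : 'I_#|PP|) : i != j ->
    [disjoint interior x z (enum_val i) & interior x z (enum_val j)].
  by move=> nij; apply: disj => //; rewrite (inj_eq enum_val_inj).
apply: (M_dome G 'I_#|PP| x w n) => //; last by rewrite card_ord size_PP.
- split=> [i|i a b la lb|i a b la lb|i j a b nij Ha Hb E].
  + by case: (uP i).
  + by case: (uP i) => _ _ _ adj_u _; apply: adj_u; exact: ltnW.
  + by case: (uP i) => _ _ inj_u _ _; apply: inj_u; exact: ltnW.
  + have /disjointFr := int_disj i j nij => /(_ (w i a)).
    have -> : w i a \in interior x z (enum_val i) by apply/intP; exists a.
    have -> : w i a \in interior x z (enum_val j) by apply/intP; exists b.
    by move=> /(_ isT).
- move=> i j nij; have nij' :
    enum_val i != enum_val j by rewrite (inj_eq enum_val_inj).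
  (* Rigidity is a negation; the boolean form of the edge allows an argument by contradiction. *)
  have edge : [exists a in interior x z (enum_val i),
      touch a (interior x z (enum_val j))].
    apply: contraT => /exists_inPn no_edge;
      case: (rig _ _ (idx i) (idx j) nij').
    split=> [|a b ia jb]; first exact: int_disj.
    by apply: contra (no_edge a ia) => ab; apply/touchP; exists b.
  have /exists_inP[_ /intP[a Ha ->] /touchP[_ /intP[b Hb ->] ab]] := edge.
  by exists a => //; apply/touchP; exists (w j b) => //; exact: mem_seg.
Qed.
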